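(* Let $n\geq4$ and $\alpha\in\mathbb{H}_\varepsilon^\perp\subset\mathbb{A}_{n+1}$. (1) If $\|\alpha\|=1$, then $\mathbb{O}_\alpha=\mathrm{Span}\{e_0,\widetilde{\varepsilon},\varepsilon,\widetilde{e}_0,\widetilde{\alpha},\alpha\varepsilon,\widetilde{\varepsilon}\alpha,\alpha\}$ is (a subalgebra of $\mathbb{A}_{n+1}$) isomorphic as an algebra to $\mathbb{A}_3$ if and only if $(\alpha,\alpha,\varepsilon)=0$. (2) If $\alpha=(a,b)\in\widetilde{\mathbb{A}}_n\times\widetilde{\mathbb{A}}_n$, then $(\alpha,\alpha,\varepsilon)=(0,-(a,\widetilde{e}_0,b))\in\widetilde{\mathbb{A}}_n\times\widetilde{\mathbb{A}}_n$, where on the right-hand side $\widetilde{e}_0\in\mathbb{A}_n$.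
   Context: Cayley-Dickson algebras: $\mathbb{A}_0=\mathbb{R}$ with $\overline{x}=x$, and $\mathbb{A}_{m+1}=\mathbb{A}_m\times\mathbb{A}_m$ with product $(a,b)(x,y)=(ax-\overline{y}b,\;ya+b\overline{x})$ and conjugation $\overline{(x_1,x_2)}=(\overline{x}_1,-x_2)$. $\mathbb{A}_m=\mathbb{R}^{2^m}$ carries the standard inner product and norm; $\perp$ denotes orthogonality or orthogonal complement. $e_0$ is the unit of each algebra. For $m\geq1$, $\widetilde{e}_0:=(0,e_0)\in\mathbb{A}_m$ (the same symbol is used in each $\mathbb{A}_m$), and for $a=(a_1,a_2)\in\mathbb{A}_m$, $\widetilde{a}:=(-a_2,a_1)$. The doubly pure elements are $\widetilde{\mathbb{A}}_m=\{e_0,\widetilde{e}_0\}^\perp\subset\mathbb{A}_m$. The associator is $(x,y,z)=(xy)z-x(yz)$. $\varepsilon:=(\widetilde{e}_0,0)\in\mathbb{A}_{n+1}$ (with $\widetilde{e}_0\in\mathbb{A}_n$), $\mathbb{H}_\varepsilon:=\mathrm{Span}\{e_0,\widetilde{\varepsilon},\varepsilon,\widetilde{e}_0\}\subset\mathbb{A}_{n+1}$ (here $\widetilde{e}_0\in\mathbb{A}_{n+1}$), and $\mathbb{H}_\varepsilon^\perp=\widetilde{\mathbb{A}}_n\times\widetilde{\mathbb{A}}_n$. *)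

(* Defs.v *)
From HB Require Import structures.
From mathcomp Require Import all_boot all_order all_algebra reals.

Set Implicit Arguments.
Unset Strict Implicit.
Unset Printing Implicit Defensive.

Import Order.TTheory GRing.Theory Num.Theory.

Local Open Scope ring_scope.

(* The recursion takes values in the structure vectType R, so that every A_m
   carries the componentwise real vector space structure of R^(2^m).
   [CD R m.+1] is convertible to [(CD R m * CD R m)%type]. *)
Fixpoint CD (R : realType) (m : nat) : vectType R :=
  match m with
  | 0 => R^o
  | m'.+1 => (CD R m' * CD R m')%type
  end.

Definition cd_pair (R : realType) (m : nat) (a b : CD R m) : CD R m.+1 :=
  (a, b).

Fixpoint cd_conj (R : realType) (m : nat) : CD R m -> CD R m :=
  match m return CD R m -> CD R m with
  | 0 => fun x => x
  | m'.+1 => fun x => cd_pair (cd_conj x.1) (- x.2)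
  end.

Fixpoint cd_mul (R : realType) (m : nat) : CD R m -> CD R m -> CD R m :=
  match m return CD R m -> CD R m -> CD R m with
  | 0 => fun x y => (x : R) * (y : R)
  | m'.+1 => fun p q =>
      cd_pair (cd_mul p.1 q.1 - cd_mul (cd_conj q.2) p.2)
              (cd_mul q.2 p.1 + cd_mul p.2 (cd_conj q.1))
  end.

Fixpoint cd_dot (R : realType) (m : nat) : CD R m -> CD R m -> R :=
  match m return CD R m -> CD R m -> R with
  | 0 => fun x y => (x : R) * (y : R)
  | m'.+1 => fun x y => cd_dot x.1 y.1 + cd_dot x.2 y.2
  end.

Definition cd_norm (R : realType) (m : nat) (x : CD R m) : R :=
  Num.sqrt (cd_dot x x).

Fixpoint cd_e0 (R : realType) (m : nat) : CD R m :=
  match m return CD R m with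
  | 0 => (1 : R)
  | m'.+1 => cd_pair (cd_e0 R m') 0
  end.

(* [cd_te0] and [cd_tilde] are only meaningful for [0 < m]; in A_0 they take
   the junk value 0. *)
Definition cd_te0 (R : realType) (m : nat) : CD R m :=
  match m return CD R m with
  | 0 => 0
  | m'.+1 => cd_pair 0 (cd_e0 R m')
  end.

Definition cd_tilde (R : realType) (m : nat) : CD R m -> CD R m :=
  match m return CD R m -> CD R m with
  | 0 => fun _ => 0
  | m'.+1 => fun a => cd_pair (- a.2) a.1
  end.

Definition cd_assoc (R : realType) (m : nat) (x y z : CD R m) : CD R m :=
  cd_mul (cd_mul x y) z - cd_mul x (cd_mul y z).

Definition cd_orth (R : realType) (m : nat) (S : {pred CD R m}) (x : CD R m) :
  Prop := forall y, y \in S -> cd_dot x y = 0.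

Definition doubly_pure (R : realType) (m : nat) (x : CD R m) : Prop :=
  cd_orth [in [:: cd_e0 R m; cd_te0 R m]] x.

Definition cd_eps (R : realType) (n : nat) : CD R n.+1 :=
  cd_pair (cd_te0 R n) 0.

Definition H_eps (R : realType) (n : nat) : {vspace CD R n.+1} :=
  <<[:: cd_e0 R n.+1; cd_tilde (cd_eps R n); cd_eps R n; cd_te0 R n.+1]>>%VS.

Definition O_ (R : realType) (n : nat) (alpha : CD R n.+1) :
  {vspace CD R n.+1} :=
  <<[:: cd_e0 R n.+1; cd_tilde (cd_eps R n); cd_eps R n; cd_te0 R n.+1;
        cd_tilde alpha; cd_mul alpha (cd_eps R n);
        cd_mul (cd_tilde (cd_eps R n)) alpha; alpha]>>%VS.

Definition cd_subalgebra (R : realType) (m : nat) (U : {vspace CD R m}) :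
  Prop := forall x y, x \in U -> y \in U -> cd_mul x y \in U.

(* [U], with the product of A_m, is isomorphic to A_k. *)
Definition cd_isomorphic (R : realType) (k m : nat) (U : {vspace CD R m}) :
  Prop :=
  exists f : 'Hom(CD R k, CD R m),
    [/\ injective f, limg f = U
      & forall x y, f (cd_mul x y) = cd_mul (f x) (f y)].

(* Main.v *)
Require Import Defs.
From HB Require Import structures.
From mathcomp Require Import all_boot all_order all_algebra reals.
From mathcomp Require Import ring.
Set Implicit Arguments.
Unset Strict Implicit.
Unset Printing Implicit Defensive.
Import Order.TTheory GRing.Theory Num.Theory.
Local Open Scope ring_scope.

(* Write alpha = (a, b) with a, b doubly pure and te = te_0 in A_n. The
   multiplication table of e_0, te, a, b and their tildes is that of the
   quaternion algebras generated by te and a, resp. te and b, except for the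
   products of an a-vector with a b-vector, and (a, te, b) = ta b + a tb. When
   this associator vanishes, the map (p, q) |-> phi(p) + phi(q) alpha, where phi
   identifies A_2 with H_eps, is multiplicative from A_3 onto O_alpha: in
   its components all remaining products of a- and b-vectors cancel. It is
   injective because z conj(z) = |z|^2 in A_3. Conversely,
   A_3 is alternative, so alpha and eps in an isomorphic copy of A_3 satisfy
   (alpha, alpha, eps) = 0. *)

Section CayleyDickson.
Variable R : realType.
Implicit Types (m : nat) (k : R).

(** * Componentwise rules and bilinearity of the product *)

Lemma cd_pair_eq m (x y : CD R m.+1) : x.1 = y.1 -> x.2 = y.2 -> x = y.
Proof. by case: x y => [x1 x2] [y1 y2] /= -> ->. Qed.

Lemma cd_mul_pair m (a b x y : CD R m) :
  cd_mul (cd_pair a b) (cd_pair x y)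
  = cd_pair (cd_mul a x - cd_mul (cd_conj y) b)
            (cd_mul y a + cd_mul b (cd_conj x)).
Proof. by []. Qed.

Lemma cd_conj_pair m (a b : CD R m) :
  cd_conj (cd_pair a b) = cd_pair (cd_conj a) (- b).
Proof. by []. Qed.

Lemma cd_dot_pair m (a b x y : CD R m) :
  cd_dot (cd_pair a b) (cd_pair x y) = cd_dot a x + cd_dot b y.
Proof. by []. Qed.

Lemma cd_pairD m (a b x y : CD R m) :
  cd_pair a b + cd_pair x y = cd_pair (a + x) (b + y).
Proof. by []. Qed.

Lemma cd_pairN m (a b : CD R m) : - cd_pair a b = cd_pair (- a) (- b).
Proof. by []. Qed.

Lemma cd_pairZ m k (a b : CD R m) :
  k *: cd_pair a b = cd_pair (k *: a) (k *: b).
Proof. by []. Qed.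

Lemma cd_conj_is_linear m : linear (@cd_conj R m).
Proof.
elim: m => [//|m IHm] k x y; apply: cd_pair_eq => /=; first exact: IHm.
by rewrite opprD scalerN.
Qed.

HB.instance Definition _ m :=
  GRing.isLinear.Build R (CD R m) (CD R m) _ (@cd_conj R m)
    (@cd_conj_is_linear m).

Lemma cd_conj0 m : cd_conj (0 : CD R m) = 0.
Proof. exact: linear0. Qed.

Lemma cd_conjN m (x : CD R m) : cd_conj (- x) = - cd_conj x.
Proof. exact: linearN. Qed.

Lemma cd_conjD m (x y : CD R m) : cd_conj (x + y) = cd_conj x + cd_conj y.
Proof. exact: linearD. Qed.

Lemma cd_conjZ m k (x : CD R m) : cd_conj (k *: x) = k *: cd_conj x.
Proof. exact: linearZ. Qed.

(** The two linearities go through one induction because doubling swaps sides: in [(a, b)(x, y)] the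
    terms [y a] and [conj(y) b] have the left factor's components on the right. *)
Lemma cd_mul_linear_pair m :
  (forall z : CD R m, linear (fun x => cd_mul x z)) /\
  (forall z : CD R m, linear (cd_mul z)).
Proof.
elim: m => [|m [IHl IHr]].
  split=> z k x y /=; rewrite /GRing.scale /=; ring.
split=> z k x y; apply: cd_pair_eq => /=.
- rewrite (IHl z.1 k x.1) (IHr _ k x.2) scalerBr opprD; exact: addrACA.
- rewrite (IHr _ k x.1) (IHl _ k x.2) scalerDr; exact: addrACA.
- rewrite (IHr z.1 k x.1) linearP (IHl _ k) scalerBr opprD; exact: addrACA.
- rewrite (IHl _ k x.2) linearP (IHr _ k) scalerDr; exact: addrACA.
Qed.

Lemma cd_mulPl m k (x y z : CD R m) :
  cd_mul (k *: x + y) z = k *: cd_mul x z + cd_mul y z.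
Proof. exact: (cd_mul_linear_pair m).1. Qed.

Lemma cd_mulPr m k (x y z : CD R m) :
  cd_mul z (k *: x + y) = k *: cd_mul z x + cd_mul z y.
Proof. exact: (cd_mul_linear_pair m).2. Qed.

Lemma cd_mulDl m (x y z : CD R m) :
  cd_mul (x + y) z = cd_mul x z + cd_mul y z.
Proof. by rewrite -[x]scale1r cd_mulPl !scale1r. Qed.

Lemma cd_mulDr m (x y z : CD R m) :
  cd_mul z (x + y) = cd_mul z x + cd_mul z y.
Proof. by rewrite -[x]scale1r cd_mulPr !scale1r. Qed.

Lemma cd_mul0l m (z : CD R m) : cd_mul 0 z = 0.
Proof. by apply: (addIr (cd_mul 0 z)); rewrite -cd_mulDl !add0r. Qed.

Lemma cd_mul0r m (z : CD R m) : cd_mul z 0 = 0.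
Proof. by apply: (addIr (cd_mul z 0)); rewrite -cd_mulDr !add0r. Qed.

Lemma cd_mulZl m k (x z : CD R m) : cd_mul (k *: x) z = k *: cd_mul x z.
Proof. by rewrite -[k *: x]addr0 cd_mulPl cd_mul0l addr0. Qed.

Lemma cd_mulZr m k (x z : CD R m) : cd_mul z (k *: x) = k *: cd_mul z x.
Proof. by rewrite -[k *: x]addr0 cd_mulPr cd_mul0r addr0. Qed.

Lemma cd_mulNl m (x z : CD R m) : cd_mul (- x) z = - cd_mul x z.
Proof. by rewrite -scaleN1r cd_mulZl scaleN1r. Qed.

Lemma cd_mulNr m (x z : CD R m) : cd_mul z (- x) = - cd_mul z x.
Proof. by rewrite -scaleN1r cd_mulZr scaleN1r. Qed.

Definition cd_mul_lin :=
  (cd_mulDl, cd_mulDr, cd_mulNl, cd_mulNr, cd_mulZl, cd_mulZr,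
   cd_mul0l, cd_mul0r).

(** * The inner product *)

Lemma cd_dotC m (x y : CD R m) : cd_dot x y = cd_dot y x.
Proof.
by elim: m x y => [|m IHm] x y /=; [exact: mulrC | congr (_ + _); apply: IHm].
Qed.

Lemma cd_dot_is_scalar m (z : CD R m) : scalar (cd_dot z).
Proof.
elim: m z => [|m IHm] z k x y /=; first by rewrite /GRing.scale /=; ring.
by rewrite (IHm z.1 k x.1) (IHm z.2 k x.2) mulrDr; exact: addrACA.
Qed.

HB.instance Definition _ m (z : CD R m) :=
  GRing.isLinear.Build R (CD R m) R _ (cd_dot z) (cd_dot_is_scalar z).

Lemma cd_dotDr m (z x y : CD R m) : cd_dot z (x + y) = cd_dot z x + cd_dot z y.
Proof. exact: linearD. Qed.

Lemma cd_dotZr m k (z x : CD R m) : cd_dot z (k *: x) = k * cd_dot z x.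
Proof. exact: linearZ. Qed.

Lemma cd_dotNr m (z x : CD R m) : cd_dot z (- x) = - cd_dot z x.
Proof. exact: linearN. Qed.

Lemma cd_dot0r m (z : CD R m) : cd_dot z 0 = 0.
Proof. exact: linear0. Qed.

Lemma cd_dotNl m (z x : CD R m) : cd_dot (- x) z = - cd_dot x z.
Proof. by rewrite cd_dotC cd_dotNr cd_dotC. Qed.

Lemma cd_dot_ge0 m (x : CD R m) : 0 <= cd_dot x x.
Proof.
by elim: m x => [|m IHm] x /=; [exact: sqr_ge0 | rewrite addr_ge0].
Qed.

Lemma cd_dot_eq0 m (x : CD R m) : cd_dot x x = 0 -> x = 0.
Proof.
elim: m x => [|m IHm] x /=; first by move/eqP; rewrite mulf_eq0 orbb => /eqP.
move/eqP; rewrite paddr_eq0 ?cd_dot_ge0 // => /andP[/eqP x10 /eqP x20].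
by apply: cd_pair_eq; apply: IHm.
Qed.

(** Pairing with an arbitrary [z] turns a vector identity into a scalar one, which [ring] can close
    with the pairings as atoms. *)
Lemma cd_dot_inj m (x y : CD R m) :
  (forall z, cd_dot z x = cd_dot z y) -> x = y.
Proof.
move=> xy; apply/eqP; rewrite -subr_eq0; apply/eqP/cd_dot_eq0.
by rewrite cd_dotDr cd_dotNr xy subrr.
Qed.

(** * Conjugation, the unit and the norm form *)

Lemma cd_conjK m : involutive (@cd_conj R m).
Proof.
by elim: m => [//|m IHm] x; apply: cd_pair_eq; rewrite /= ?opprK ?IHm.
Qed.

Lemma cd_conj_mul m (x y : CD R m) :
  cd_conj (cd_mul x y) = cd_mul (cd_conj y) (cd_conj x).
Proof.
elim: m x y => [|m IHm] x y; first exact: mulrC.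
apply: cd_pair_eq => /=.
  by rewrite linearB /= !IHm cd_conjK cd_conjN !cd_mul_lin opprK.
by rewrite !cd_mul_lin cd_conjK opprD addrC.
Qed.

Lemma cd_conj_e0 m : cd_conj (cd_e0 R m) = cd_e0 R m.
Proof. by elim: m => [//|m IHm] /=; rewrite oppr0 IHm. Qed.

Lemma cd_dot_e0_e0 m : cd_dot (cd_e0 R m) (cd_e0 R m) = 1.
Proof. by elim: m => [|m IHm] /=; rewrite ?mulr1 // IHm cd_dot0r addr0. Qed.

Lemma cd_mul1l m (x : CD R m) : cd_mul (cd_e0 R m) x = x.
Proof.
elim: m x => [|m IHm] x /=; first exact: mul1r.
apply: cd_pair_eq; rewrite /= !cd_mul_lin ?subr0 ?addr0 ?IHm //.
(* The second component is [x.2] times [e_0] on the right; conjugation moves the unit to the left,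
   where the induction hypothesis applies. *)
by rewrite -[LHS]cd_conjK cd_conj_mul cd_conj_e0 IHm cd_conjK.
Qed.

Lemma cd_mul1r m (x : CD R m) : cd_mul x (cd_e0 R m) = x.
Proof. by rewrite -[LHS]cd_conjK cd_conj_mul cd_conj_e0 cd_mul1l cd_conjK. Qed.

Lemma cd_dot_e0_conj m (x : CD R m) :
  cd_dot x (cd_e0 R m) = 0 -> cd_conj x = - x.
Proof.
elim: m x => [|m IHm] x /=.
  by rewrite mulr1 => ->; rewrite oppr0.
by rewrite cd_dot0r addr0 => /IHm x1; apply: cd_pair_eq.
Qed.

Lemma cd_dot_conj m (x y : CD R m) :
  cd_dot (cd_conj x) (cd_conj y) = cd_dot x y.
Proof.
elim: m x y => [//|m IHm] x y /=.
by rewrite IHm cd_dotNl cd_dotNr opprK.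
Qed.

Lemma cd_dot_e0_mul m (x y : CD R m) :
  cd_dot (cd_mul x y) (cd_e0 R m) = cd_dot x (cd_conj y).
Proof.
elim: m x y => [|m IHm] x y /=; first by rewrite mulr1.
rewrite cd_dot0r addr0 cd_dotC cd_dotDr cd_dotNr !(cd_dotC (cd_e0 _ _)) !IHm.
by rewrite cd_dot_conj cd_dotNr (cd_dotC y.2).
Qed.

Lemma cd_mul_conj m (x : CD R m) :
  cd_mul x (cd_conj x) = cd_dot x x *: cd_e0 R m.
Proof.
(* Both orders are proved together, since the first component of [x conj(x)] is
   [x1 conj(x1) + conj(x2) x2]. *)
suff [] : cd_mul x (cd_conj x) = cd_dot x x *: cd_e0 R m
  /\ cd_mul (cd_conj x) x = cd_dot x x *: cd_e0 R m by [].
elim: m x => [|m IHm] x; first by rewrite /GRing.scale /= mulr1.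
split; apply: cd_pair_eq => /=;
  rewrite ?scaler0 ?scalerDl ?cd_conjN !cd_mul_lin ?opprK ?cd_conjK
    ?(IHm _).1 ?(IHm _).2 //.
- by rewrite addrC subrr.
- by rewrite subrr.
Qed.

Lemma cd_sqr_pure m (x : CD R m) :
  cd_conj x = - x -> cd_mul x x = - (cd_dot x x *: cd_e0 R m).
Proof. by move=> xN; rewrite -cd_mul_conj xN cd_mul_lin opprK. Qed.

(** In coordinates this is eight polynomial identities in sixteen real variables. *)
Lemma cd_alternative3 (x y : CD R 3) : cd_assoc x x y = 0.
Proof.
case: x y => [[[x0 x1] [x2 x3]] [[x4 x5] [x6 x7]]].
case=> [[[y0 y1] [y2 y3]] [[y4 y5] [y6 y7]]].
apply: (@cd_pair_eq 2); apply: (@cd_pair_eq 1); apply: (@cd_pair_eq 0) => /=;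
ring.
Qed.

(** * Doubly pure elements and multiplication by [te_0] *)

Lemma doubly_pureP m (a : CD R m.+1) :
  doubly_pure a <-> cd_dot a.1 (cd_e0 R m) = 0 /\ cd_dot a.2 (cd_e0 R m) = 0.
Proof.
have e0E : cd_dot a (cd_e0 R m.+1) = cd_dot a.1 (cd_e0 R m).
  by rewrite /= cd_dot0r addr0.
have te0E : cd_dot a (cd_te0 R m.+1) = cd_dot a.2 (cd_e0 R m).
  by rewrite /= cd_dot0r add0r.
split=> [aP | [a1 a2] y].
  by rewrite -e0E -te0E; split; apply: aP; rewrite !inE eqxx ?orbT.
by rewrite !inE => /orP[] /eqP->; rewrite ?e0E ?te0E.
Qed.

Lemma doubly_pure_conj m (a : CD R m.+1) : doubly_pure a -> cd_conj a = - a.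
Proof.
move=> /doubly_pureP[a1 _]; apply: cd_dot_e0_conj.
by rewrite /= a1 cd_dot0r addr0.
Qed.

Lemma doubly_pure_tilde m (a : CD R m.+1) :
  doubly_pure a -> doubly_pure (cd_tilde a).
Proof.
move=> /doubly_pureP[a1 a2]; apply/doubly_pureP.
by rewrite /= cd_dotNl a1 a2 oppr0.
Qed.

Lemma doubly_pureN m (a : CD R m.+1) : doubly_pure a -> doubly_pure (- a).
Proof.
move=> /doubly_pureP[a1 a2]; apply/doubly_pureP.
by rewrite /= !cd_dotNl a1 a2 oppr0.
Qed.

Lemma cd_tildeK m (a : CD R m.+1) : cd_tilde (cd_tilde a) = - a.
Proof. exact: cd_pair_eq. Qed.

Lemma cd_mul_te0 m (a : CD R m.+1) : cd_mul a (cd_te0 R m.+1) = cd_tilde a.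
Proof.
by apply: cd_pair_eq; rewrite /= ?cd_conj0 ?cd_conj_e0 !cd_mul_lin ?cd_mul1l
  ?add0r ?addr0.
Qed.

(** In general [te_0 (a1, a2) = (- conj a2, conj a1)]; purity of both halves turns this into
    [(a2, - a1)]. *)
Lemma cd_te0_mul m (a : CD R m.+1) :
  doubly_pure a -> cd_mul (cd_te0 R m.+1) a = - cd_tilde a.
Proof.
move=> /doubly_pureP[/cd_dot_e0_conj a1 /cd_dot_e0_conj a2].
by apply: cd_pair_eq; rewrite /= ?a1 ?a2 !cd_mul_lin
  ?cd_mul1l ?cd_mul1r ?add0r ?opprK.
Qed.

Lemma cd_conj_te0 m : cd_conj (cd_te0 R m.+1) = - cd_te0 R m.+1.
Proof. by apply: cd_pair_eq; rewrite //= cd_conj0 oppr0. Qed.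

Lemma cd_te0_sqr m :
  cd_mul (cd_te0 R m.+1) (cd_te0 R m.+1) = - cd_e0 R m.+1.
Proof. by rewrite cd_mul_te0; apply: cd_pair_eq; rewrite //= oppr0. Qed.

Lemma cd_dot_tilde m (a : CD R m.+1) :
  cd_dot (cd_tilde a) (cd_tilde a) = cd_dot a a.
Proof. by rewrite /= cd_dotNl cd_dotNr opprK addrC. Qed.

(** For pure halves the two products [a1 a2] in the first component cancel, and the second component
    is [a1 a1 + a2 a2], a sum of two negative squared norms. *)
Lemma cd_mul_tilde m (a : CD R m.+1) : doubly_pure a ->
  cd_mul a (cd_tilde a) = - (cd_dot a a *: cd_te0 R m.+1).
Proof.
move=> /doubly_pureP[/cd_dot_e0_conj a1 /cd_dot_e0_conj a2].
apply: cd_pair_eq; rewrite /= ?cd_conjN ?a1 ?a2 !cd_mul_lin.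
  by rewrite scaler0 oppr0 opprK addrC subrr.
by rewrite !cd_sqr_pure // scalerDl opprD opprK.
Qed.

Lemma cd_tilde_mul m (a : CD R m.+1) : doubly_pure a ->
  cd_mul (cd_tilde a) a = cd_dot a a *: cd_te0 R m.+1.
Proof.
move=> aP; have taP := doubly_pure_tilde aP.
rewrite -[LHS]cd_conjK cd_conj_mul (doubly_pure_conj aP) (doubly_pure_conj taP).
rewrite !cd_mul_lin opprK cd_mul_tilde // cd_conjN cd_conjZ cd_conj_te0.
by rewrite scalerN opprK.
Qed.

(** * A multiplicative map from A_3, deduced from an abstract multiplication table *)

Section OctComb.
Variables (m : nat) (e c a b ta tb : CD R m) (d : R).

(* With [e], [c] the units [e_0], [te_0] and [ta], [tb] the tildes of [a], [b],
   this is [(p, q) |-> phi p + phi q * (a, b)], where [phi] is the doubling of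
   the embedding [(x, y) |-> x *: e + y *: c] of A_1. Keeping the six vectors
   abstract prevents simplification from unfolding them into components. *)
Definition oct_comb (x : CD R 3) : CD R m.+1 :=
  cd_pair
    ((x.1.1.1 : R) *: e + (x.1.1.2 : R) *: c + (x.2.1.1 : R) *: a
     + (x.2.2.1 : R) *: b - (x.2.1.2 : R) *: ta + (x.2.2.2 : R) *: tb)
    ((x.1.2.1 : R) *: e + (x.1.2.2 : R) *: c + (x.2.1.1 : R) *: b
     - (x.2.2.1 : R) *: a + (x.2.1.2 : R) *: tb + (x.2.2.2 : R) *: ta).

(** Here [d] stands for the squared norm of [a], so that [1 - d] is that of [b] when [(a, b)] has
    norm 1. *)
Hypotheses (mul_el : forall u, cd_mul e u = u)
  (mul_er : forall u, cd_mul u e = u) (mul_cc : cd_mul c c = - e)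
  (mul_ac : cd_mul a c = ta) (mul_bc : cd_mul b c = tb)
  (mul_tac : cd_mul ta c = - a) (mul_tbc : cd_mul tb c = - b)
  (mul_ca : cd_mul c a = - ta) (mul_cb : cd_mul c b = - tb)
  (mul_cta : cd_mul c ta = a) (mul_ctb : cd_mul c tb = b)
  (mul_aa : cd_mul a a = - (d *: e)) (mul_ata : cd_mul a ta = - (d *: c))
  (mul_taa : cd_mul ta a = d *: c) (mul_tata : cd_mul ta ta = - (d *: e))
  (mul_bb : cd_mul b b = - ((1 - d) *: e))
  (mul_btb : cd_mul b tb = - ((1 - d) *: c))
  (mul_tbb : cd_mul tb b = (1 - d) *: c)
  (mul_tbtb : cd_mul tb tb = - ((1 - d) *: e))
  (mul_atb : cd_mul a tb = - cd_mul ta b)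
  (mul_bta : cd_mul b ta = - cd_mul tb a)
  (conj_e : cd_conj e = e) (conj_c : cd_conj c = - c)
  (conj_a : cd_conj a = - a) (conj_b : cd_conj b = - b)
  (conj_ta : cd_conj ta = - ta) (conj_tb : cd_conj tb = - tb).

Lemma oct_combE (x0 x1 x2 x3 x4 x5 x6 x7 : R) :
  oct_comb (((x0, x1), (x2, x3)), ((x4, x5), (x6, x7)))
  = cd_pair
    (x0 *: e + x1 *: c + x4 *: a + x6 *: b - x5 *: ta + x7 *: tb)
    (x2 *: e + x3 *: c + x4 *: b - x6 *: a + x5 *: tb + x7 *: ta).
Proof. by []. Qed.

(* The products [a b], [b a], [ta tb], [tb ta] are unknown, but cancel; the
   mixed ones only cancel because of [mul_atb] and [mul_bta]. *)
Lemma oct_comb_mul (x y : CD R 3) :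
  oct_comb (cd_mul x y) = cd_mul (oct_comb x) (oct_comb y).
Proof.
case: x y => [[[x0 x1] [x2 x3]] [[x4 x5] [x6 x7]]].
case=> [[[y0 y1] [y2 y3]] [[y4 y5] [y6 y7]]].
rewrite [in RHS]oct_combE [in RHS]oct_combE cd_mul_pair.
congr cd_pair; rewrite [LHS]/=; rewrite !(cd_conjD, cd_conjN, cd_conjZ);
  rewrite conj_e conj_c conj_a conj_b ?(conj_ta, conj_tb) !cd_mul_lin;
  rewrite !(mul_el, mul_er) mul_cc mul_ac mul_bc mul_tac mul_tbc mul_ca mul_cb;
  rewrite mul_cta mul_ctb mul_aa mul_ata mul_taa mul_tata mul_bb mul_btb;
  rewrite mul_tbb mul_tbtb mul_atb mul_bta;
  apply: cd_dot_inj => z; rewrite !(cd_dotDr, cd_dotZr, cd_dotNr); ring.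
Qed.

Lemma oct_comb_is_linear : linear oct_comb.
Proof.
move=> k [[[x0 x1] [x2 x3]] [[x4 x5] [x6 x7]]].
move=> [[[y0 y1] [y2 y3]] [[y4 y5] [y6 y7]]].
rewrite [in RHS]oct_combE [in RHS]oct_combE cd_pairZ cd_pairD.
by congr cd_pair; apply: cd_dot_inj => z;
  rewrite /= !(cd_dotDr, cd_dotZr, cd_dotNr) /GRing.scale /=; ring.
Qed.

HB.instance Definition _ :=
  GRing.isLinear.Build R (CD R 3) (CD R m.+1) _ oct_comb oct_comb_is_linear.

End OctComb.

(** * The associator with [eps] and the span [O_alpha] for [alpha = (a, b)] *)

Section TwoPureVectors.
Variables (m : nat) (a b : CD R m.+1).
Hypotheses (aP : doubly_pure a) (bP : doubly_pure b).

Let taP := doubly_pure_tilde aP.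
Let tbP := doubly_pure_tilde bP.

Lemma cd_assoc_te0 :
  cd_assoc a (cd_te0 R m.+1) b
  = cd_mul (cd_tilde a) b + cd_mul a (cd_tilde b).
Proof. by rewrite /cd_assoc cd_mul_te0 cd_te0_mul // cd_mulNr opprK. Qed.

(** Each component of [ta b + a tb] is a sum of two commutators of pure halves, and a commutator has
    no real part because the real part of [x y] is the symmetric form [<x, conj y>]. *)
Lemma doubly_pure_assoc_te0 : doubly_pure (cd_assoc a (cd_te0 R m.+1) b).
Proof.
have [a1 a2] := (doubly_pureP _).1 aP; have [b1 b2] := (doubly_pureP _).1 bP.
have [a1N a2N] := (cd_dot_e0_conj a1, cd_dot_e0_conj a2).
have [b1N b2N] := (cd_dot_e0_conj b1, cd_dot_e0_conj b2).
rewrite cd_assoc_te0; apply/doubly_pureP; split; rewrite /=;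
  rewrite cd_dotC !(cd_dotDr, cd_dotNr) !(cd_dotC (cd_e0 R m)) !cd_dot_e0_mul;
  rewrite ?(cd_conjK, cd_conjN, a1N, a2N, b1N, b2N) !(cd_dotNl, cd_dotNr);
  rewrite (cd_dotC b.2) (cd_dotC b.1); ring.
Qed.

(** Conjugation reverses the products in [ta b + a tb], and negates the associator because it is
    pure. *)
Lemma cd_assoc_te0_swap :
  cd_mul (cd_tilde b) a + cd_mul b (cd_tilde a)
  = - cd_assoc a (cd_te0 R m.+1) b.
Proof.
rewrite -(doubly_pure_conj doubly_pure_assoc_te0) cd_assoc_te0 cd_conjD.
by rewrite !cd_conj_mul !doubly_pure_conj // !cd_mul_lin !opprK addrC.
Qed.

Lemma cd_mul_pair_eps :
  cd_mul (cd_pair a b) (cd_eps R m.+1) = cd_pair (cd_tilde a) (- cd_tilde b).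
Proof.
rewrite cd_mul_pair cd_conj0 cd_conj_te0 !cd_mul_lin !cd_mul_te0.
by rewrite subr0 add0r.
Qed.

Lemma cd_teps_mul_pair :
  cd_mul (cd_tilde (cd_eps R m.+1)) (cd_pair a b)
  = cd_pair (cd_tilde b) (cd_tilde a).
Proof.
rewrite cd_mul_pair !doubly_pure_conj // oppr0 !cd_mul_lin cd_mul_te0.
by rewrite cd_te0_mul // !opprK !add0r.
Qed.

(** Since [alpha] is pure, [(alpha alpha) eps] is [- |alpha|^2 eps]. This matches the first
    component of [alpha (alpha eps)]; the second component is [- (tb a + b ta)], the swapped form of
    the associator. *)
Lemma cd_assoc_eps :
  cd_assoc (cd_pair a b) (cd_pair a b) (cd_eps R m.+1)
  = cd_pair 0 (- cd_assoc a (cd_te0 R m.+1) b).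
Proof.
rewrite /cd_assoc cd_mul_pair_eps cd_sqr_pure; last first.
  by rewrite cd_conj_pair doubly_pure_conj.
rewrite cd_mulNl cd_mulZl cd_mul1l -/(cd_assoc a _ b) -cd_assoc_te0_swap.
rewrite cd_mul_pair cd_conjN !doubly_pure_conj // !cd_mul_lin.
rewrite cd_mul_tilde // opprK cd_tilde_mul //.
rewrite cd_pairZ cd_pairN cd_pairN cd_pairD scaler0 oppr0 add0r.
congr cd_pair; first by rewrite cd_dot_pair scalerDl -!opprD subrr oppr0.
by rewrite opprD !opprK.
Qed.

Hypothesis ab1 : cd_dot a a + cd_dot b b = 1.

Let oct :=
  oct_comb (cd_e0 R m.+1) (cd_te0 R m.+1) a b (cd_tilde a) (cd_tilde b).
Let alpha := cd_pair a b.

(** The coordinates on A_3 are, up to sign, coefficients of the generators of [O_alpha]; the image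
    of [oct] and its value at the unit are read off from this. *)
Lemma oct_comb_gens (x0 x1 x2 x3 x4 x5 x6 x7 : R) :
  oct (((x0, x1), (x2, x3)), ((x4, x5), (x6, x7)))
  = x0 *: cd_e0 R m.+2 + x1 *: cd_eps R m.+1 + x2 *: cd_te0 R m.+2
    + x3 *: cd_tilde (cd_eps R m.+1) + x4 *: alpha
    - x5 *: cd_mul alpha (cd_eps R m.+1) - x6 *: cd_tilde alpha
    + x7 *: cd_mul (cd_tilde (cd_eps R m.+1)) alpha.
Proof.
apply: cd_dot_inj => z; rewrite cd_mul_pair_eps cd_teps_mul_pair /oct oct_combE.
(* Only the outer pair is split, so that the inner products in the halves remain atoms for
   [ring]. *)
have zE u v : cd_dot z (cd_pair u v)
  = cd_dot (z.1 : CD R m.+1) u + cd_dot (z.2 : CD R m.+1) v by [].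
have -> : cd_e0 R m.+2 = cd_pair (cd_e0 R m.+1) 0 by [].
have -> : cd_te0 R m.+2 = cd_pair 0 (cd_e0 R m.+1) by [].
have -> : cd_tilde (cd_eps R m.+1) = cd_pair 0 (cd_te0 R m.+1).
  by rewrite -[X in cd_pair X _]oppr0.
have -> : cd_tilde alpha = cd_pair (- b) a by [].
rewrite !(cd_dotDr, cd_dotZr, cd_dotNr) !zE !(cd_dotDr, cd_dotZr, cd_dotNr).
by rewrite !cd_dot0r; ring.
Qed.

Let octE x : linfun oct x = oct x.
Proof. exact: lfunE. Qed.

Lemma limg_oct_comb : limg (linfun oct) = O_ alpha.
Proof.
apply/eqP; rewrite eqEsubv; apply/andP; split.
  apply/subvP => _ /memv_imgP[x _ ->]; rewrite octE.
  case: x => [[[x0 x1] [x2 x3]] [[x4 x5] [x6 x7]]]; rewrite oct_comb_gens.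
  by rewrite !(rpredD, rpredN, rpredZ) // memv_span // !inE eqxx ?orbT.
apply/span_subvP => v vP.
suff [x ->] : exists x, v = oct x.
  by rewrite -octE memv_img ?memvf.
have gens := oct_comb_gens.
move: vP; rewrite !inE.
move=> /or4P[|||/or4P[|||/orP[]]] /eqP->.
- exists (((1, 0), (0, 0)), ((0, 0), (0, 0))); rewrite gens.
  by rewrite !(scale0r, scale1r, oppr0, addr0, add0r).
- exists (((0, 0), (0, 1)), ((0, 0), (0, 0))); rewrite gens.
  by rewrite !(scale0r, scale1r, oppr0, addr0, add0r).
- exists (((0, 1), (0, 0)), ((0, 0), (0, 0))); rewrite gens.
  by rewrite !(scale0r, scale1r, oppr0, addr0, add0r).
- exists (((0, 0), (1, 0)), ((0, 0), (0, 0))); rewrite gens.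
  by rewrite !(scale0r, scale1r, oppr0, addr0, add0r).
(* This generator and the next enter [oct_comb_gens] with a minus sign, hence the [- 1] in their
   preimages. *)
- exists (((0, 0), (0, 0)), ((0, 0), (- 1, 0))); rewrite gens.
  by rewrite !(scale0r, scaleN1r, opprK, oppr0, addr0, add0r).
- exists (((0, 0), (0, 0)), ((0, - 1), (0, 0))); rewrite gens.
  by rewrite !(scale0r, scaleN1r, opprK, oppr0, addr0, add0r).
- exists (((0, 0), (0, 0)), ((0, 0), (0, 1))); rewrite gens.
  by rewrite !(scale0r, scale1r, oppr0, addr0, add0r).
- exists (((0, 0), (0, 0)), ((1, 0), (0, 0))); rewrite gens.
  by rewrite !(scale0r, scale1r, oppr0, addr0, add0r).
Qed.

Hypothesis ab : cd_assoc a (cd_te0 R m.+1) b = 0.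

Lemma oct_comb_pure_mul (x y : CD R 3) :
  oct (cd_mul x y) = cd_mul (oct x) (oct y).
Proof.
have bb : cd_dot b b = 1 - cd_dot a a by rewrite -ab1 addrAC subrr add0r.
apply: (@oct_comb_mul _ _ _ _ _ _ _ (cd_dot a a)).
- exact: cd_mul1l.
- exact: cd_mul1r.
- exact: cd_te0_sqr.
- exact: cd_mul_te0.
- exact: cd_mul_te0.
- by rewrite cd_mul_te0 cd_tildeK.
- by rewrite cd_mul_te0 cd_tildeK.
- exact: cd_te0_mul.
- exact: cd_te0_mul.
- by rewrite cd_te0_mul // cd_tildeK opprK.
- by rewrite cd_te0_mul // cd_tildeK opprK.
- exact/cd_sqr_pure/doubly_pure_conj.
- exact: cd_mul_tilde.
- exact: cd_tilde_mul.
- by rewrite (cd_sqr_pure (doubly_pure_conj taP)) cd_dot_tilde.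
- by rewrite (cd_sqr_pure (doubly_pure_conj bP)) bb.
- by rewrite cd_mul_tilde // bb.
- by rewrite cd_tilde_mul // bb.
- by rewrite (cd_sqr_pure (doubly_pure_conj tbP)) cd_dot_tilde bb.
(* The vanishing associator enters in this goal and, in its conjugated form, in the next. *)
- by apply/eqP; rewrite -addr_eq0 addrC -cd_assoc_te0 ab.
- by apply/eqP; rewrite -addr_eq0 addrC cd_assoc_te0_swap ab oppr0.
- exact: cd_conj_e0.
- exact: cd_conj_te0.
- exact: doubly_pure_conj.
- exact: doubly_pure_conj.
- exact: doubly_pure_conj.
- exact: doubly_pure_conj.
Qed.

Lemma O_pair_isomorphic : cd_isomorphic 3 (O_ alpha).
Proof.
exists (linfun oct); split; last 2 first.
- exact: limg_oct_comb.
- by move=> x y; rewrite !octE; apply: oct_comb_pure_mul.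
move=> x y; rewrite !octE => fxy; apply/eqP; rewrite -subr_eq0.
set z := x - y.
have fz : oct z = 0.
  have -> : oct z = oct x - oct y by exact: linearB.
  by rewrite fxy subrr.
have oct1 : oct (cd_e0 R 3) = cd_e0 R m.+2.
  apply: (etrans (oct_comb_gens 1 0 0 0 0 0 0 0)).
  by rewrite !(scale0r, scale1r, oppr0, addr0, add0r).
(* A unital multiplicative map with [f z = 0] kills [z * conj z = |z|^2]. *)
have : cd_dot z z *: cd_e0 R m.+2 = 0.
  have <- : oct (cd_mul z (cd_conj z)) = cd_dot z z *: cd_e0 R m.+2.
    rewrite cd_mul_conj -oct1; exact: linearZ.
  by rewrite oct_comb_pure_mul fz; apply: cd_mul0l.
move/(congr1 (cd_dot (cd_e0 R m.+2))); rewrite cd_dotZr cd_dot0r.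
rewrite (cd_dot_e0_e0 m.+2) mulr1 => /cd_dot_eq0 ->; exact: eqxx.
Qed.
End TwoPureVectors.

(** * Consequences of an isomorphism, and the orthogonality condition *)

Lemma cd_isomorphic_subalgebra l m (U : {vspace CD R m}) :
  cd_isomorphic l U -> cd_subalgebra U.
Proof.
move=> [f [_ <- fM]] _ _ /memv_imgP[x _ ->] /memv_imgP[y _ ->].
by rewrite -fM memv_img ?memvf.
Qed.

Lemma cd_isomorphic3_alternative m (U : {vspace CD R m}) x y :
  cd_isomorphic 3 U -> x \in U -> y \in U -> cd_assoc x x y = 0.
Proof.
move=> [f [_ <- fM]] /memv_imgP[u _ ->] /memv_imgP[v _ ->].
suff <- : f (cd_assoc u u v) = cd_assoc (f u) (f u) (f v).
  by rewrite cd_alternative3 linear0.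
have fB p q : f (p - q) = f p - f q by exact: linearB.
by rewrite /cd_assoc fB !fM.
Qed.

(** The four generators of [H_eps] are [(e_0, 0)], [(0, te_0)], [(te_0, 0)] and [(0, e_0)], so each
    tests a single half. *)
Lemma H_eps_orth_pair m (a b : CD R m.+1) :
  cd_orth (H_eps R m.+1) (cd_pair a b) -> doubly_pure a /\ doubly_pure b.
Proof.
move=> abP.
have abH y : y \in [:: cd_e0 R m.+2; cd_tilde (cd_eps R m.+1);
    cd_eps R m.+1; cd_te0 R m.+2] -> cd_dot (cd_pair a b) y = 0.
  by move=> yP; apply/abP/memv_span.
split=> y; rewrite !inE => /orP[] /eqP ->.
- rewrite -[LHS]addr0 -[X in _ + X](cd_dot0r b).
  by apply: (abH (cd_e0 R m.+2)); rewrite !inE eqxx.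
- rewrite -[LHS]addr0 -[X in _ + X](cd_dot0r b).
  by apply: (abH (cd_eps R m.+1)); rewrite !inE eqxx ?orbT.
- rewrite -[LHS]add0r -[X in X + _](cd_dot0r a).
  by apply: (abH (cd_te0 R m.+2)); rewrite !inE eqxx ?orbT.
- rewrite -[LHS]add0r -[X in X + _](cd_dot0r a) -[X in cd_dot a X]oppr0.
  by apply: (abH (cd_tilde (cd_eps R m.+1))); rewrite !inE eqxx ?orbT.
Qed.

End CayleyDickson.

Theorem lemma4p4 (R : realType) (n : nat) (hn : (4 <= n)%N)
    (alpha : CD R n.+1) (halpha : cd_orth (H_eps R n) alpha) :
  (cd_norm alpha = 1 ->
     (cd_subalgebra (O_ alpha) /\ cd_isomorphic 3 (O_ alpha) <->
      cd_assoc alpha alpha (cd_eps R n) = 0))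
  /\
  (forall a b : CD R n,
     doubly_pure a -> doubly_pure b -> alpha = cd_pair a b ->
     cd_assoc alpha alpha (cd_eps R n)
       = cd_pair 0 (- cd_assoc a (cd_te0 R n) b)
     /\ doubly_pure (0 : CD R n)
     /\ doubly_pure (- cd_assoc a (cd_te0 R n) b)).
Proof.
(* With [n] a successor, [te_0] and the tilde in A_n have their genuine values instead of the
   default 0. *)
case: n hn alpha halpha => [//|m] _ alpha.
have [a [b ->]] : exists a b : CD R m.+1, alpha = cd_pair a b.
  by exists alpha.1, alpha.2; case: alpha.
move=> /H_eps_orth_pair[aP bP].
split=> [ab1 | a' b' a'P b'P [-> ->]]; last first.
  split; first exact: cd_assoc_eps.
  split; last exact/doubly_pureN/doubly_pure_assoc_te0.
  by move=> y _; rewrite cd_dotC; apply: cd_dot0r.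
split=> [[_ iso] | ].
  by apply: (cd_isomorphic3_alternative iso); apply: memv_span;
    rewrite !inE eqxx ?orbT.
rewrite cd_assoc_eps // => assoc0.
suff iso : cd_isomorphic 3 (O_ (cd_pair a b)).
  by split=> //; apply: cd_isomorphic_subalgebra iso.
apply: O_pair_isomorphic => //.
  (* The norm is a square root, so its value 1 is squared to get [|a|^2 + |b|^2 = 1]. *)
  rewrite -[LHS]sqr_sqrtr ?(cd_dot_ge0 (cd_pair a b)) //.
  by rewrite -[Num.sqrt _]/(cd_norm (cd_pair a b)) ab1 expr1n.
by apply: oppr_inj; rewrite oppr0; apply: (congr1 snd assoc0).
Qed.
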